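(* For every integer $s\ge0$, let $n_s=5(2^s-1)+18\cdot2^s$. Then for every parameter vector $\mathsf{Param}$ of degree $n_s$, $$\dim_{\mathbb F_2}(Q^{\otimes5})^{\mathsf{Param}}\le\prod_{1\le j\le5}(2^j-1).$$
   Context: $\mathscr A$ is the mod-2 Steenrod algebra and $\overline{\mathscr A}$ its positive-degree part. $\mathcal P_m=\mathbb F_2[x_1,\ldots,x_m]$, $|x_i|=1$, is an $\mathscr A$-module via $Sq^k(x_j^n)=\binom nk x_j^{n+k}$ and the Cartan formula. For $n\ge0$ write $n=\sum_{t\ge0}\alpha_t(n)2^t$ in binary. The parameter vector of a monomial $X=x_1^{u_1}\cdots x_m^{u_m}$ is $\mathsf{Param}(X)=(\mathsf{Param}_1(X),\mathsf{Param}_2(X),\ldots)$ with $\mathsf{Param}_i(X)=\sum_{1\le j\le m}\alpha_{i-1}(u_j)$. In general a parameter vector is a sequence $\mathsf{Param}=(\mathsf{Param}_1,\mathsf{Param}_2,\ldots)$ of non-negative integers with $\mathsf{Param}_i=0$ for $i\gg0$; its degree is $\deg(\mathsf{Param})=\sum_{i\ge1}2^{i-1}\mathsf{Param}_i$. Parameter vectors are ordered left-lexicographically. $\mathcal P_m^{\le\mathsf{Param}}$ (resp. $\mathcal P_m^{<\mathsf{Param}}$) is the span of monomials $X$ of degree $\deg(\mathsf{Param})$ with $\mathsf{Param}(X)\le\mathsf{Param}$ (resp. $<$). For $F,G\in\mathcal P_m^{\le\mathsf{Param}}$, $F\sim_{\mathsf{Param}}G$ means $F+G\in\overline{\mathscr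 A}\mathcal P_m+\mathcal P_m^{<\mathsf{Param}}$; $(Q^{\otimes m})^{\mathsf{Param}}$ is the quotient of $\mathcal P_m^{\le\mathsf{Param}}$ by $\sim_{\mathsf{Param}}$, i.e. $\mathcal P_m^{\le\mathsf{Param}}/\big((\overline{\mathscr A}\mathcal P_m\cap\mathcal P_m^{\le\mathsf{Param}})+\mathcal P_m^{<\mathsf{Param}}\big)$. *)

(* Defs.v *)
From HB Require Import structures.
From mathcomp Require Import all_boot all_order all_algebra.
From mathcomp Require Import finmap.
From mathcomp.multinomials Require Import freeg mpoly.

Set Implicit Arguments.
Unset Strict Implicit.
Unset Printing Implicit Defensive.

Import GRing.Theory.
Local Open Scope ring_scope.

(* Total square, as a polynomial in an auxiliary variable 'X marking the
   degree of the operation: the ring morphism x_i |-> x_i + x_i^2 'X.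
   Its multiplicativity is the Cartan formula. *)
Definition tot_Sq (m : nat) (f : {mpoly 'F_2[m]}) : {poly {mpoly 'F_2[m]}} :=
  mmap (fun c => (c%:MP)%:P) (fun i => ('X_i)%:P + 'X_i ^+ 2 *: 'X) f.

Definition Sq (m k : nat) (f : {mpoly 'F_2[m]}) : {mpoly 'F_2[m]} :=
  (tot_Sq f)`_k.

Definition Sq_word (m : nat) (w : seq nat) (f : {mpoly 'F_2[m]}) :
    {mpoly 'F_2[m]} :=
  foldr (@Sq m) f w.

(* The Steenrod algebra is generated by the Sq^k, so its positive-degree part
   is spanned by the words Sq^{w_1} ... Sq^{w_r} with w_1 + ... + w_r > 0
   (Sq^0 = 1); the submodule it generates consists of the finite sums of values
   of such words.  The Adem relations hold on polynomials and so do not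
   affect this submodule. *)
Definition hit (m : nat) (f : {mpoly 'F_2[m]}) : Prop :=
  exists s : seq (seq nat * {mpoly 'F_2[m]}),
    all (fun wg => 0 < sumn wg.1)%N s /\
    f = \sum_(wg <- s) Sq_word wg.1 wg.2.

Section SteenrodSquares.
Variable m : nat.
Implicit Types f g : {mpoly 'F_2[m]}.

Let cF : {rmorphism 'F_2 -> {poly {mpoly 'F_2[m]}}} :=
  (@polyC {mpoly 'F_2[m]} \o @mpolyC m 'F_2).

Lemma tot_SqE f :
  tot_Sq f = mmap cF (fun i => ('X_i)%:P + 'X_i ^+ 2 *: 'X) f.
Proof. by []. Qed.

Lemma tot_SqM f g : tot_Sq (f * g) = tot_Sq f * tot_Sq g.
Proof. by rewrite !tot_SqE rmorphM. Qed.

Lemma tot_SqXn f n : tot_Sq (f ^+ n) = tot_Sq f ^+ n.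
Proof. by rewrite !tot_SqE rmorphXn. Qed.

Lemma tot_SqX (i : 'I_m) :
  tot_Sq 'X_i = ('X_i)%:P + ('X_i : {mpoly 'F_2[m]}) ^+ 2 *: 'X.
Proof. by rewrite tot_SqE mmapX mmap1U. Qed.

Lemma Sq_linear k : linear (@Sq m k).
Proof.
move=> c f g; rewrite /Sq !tot_SqE mmapD mmapZ coefD /=.
by rewrite coefCM mul_mpolyC.
Qed.

HB.instance Definition _ k :=
  GRing.isLinear.Build 'F_2 {mpoly 'F_2[m]} {mpoly 'F_2[m]} _ (@Sq m k)
    (@Sq_linear k).

Lemma Sq_cartan k f g :
  Sq k (f * g) = \sum_(i < k.+1) Sq i f * Sq (k - i) g.
Proof. by rewrite /Sq tot_SqM coefM. Qed.

Lemma Sq_Xn k (i : 'I_m) n :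
  Sq k ('X_i ^+ n) = ('X_i ^+ (n + k)) *+ 'C(n, k).
Proof.
rewrite /Sq tot_SqXn tot_SqX exprDn coef_sum.
rewrite (eq_bigr (fun j : 'I_n.+1 =>
  ('X_i ^+ (n + j)) *+ 'C(n, j) *+ (k == j))); last first.
  move=> j _; rewrite coefMn -rmorphXn /= exprZn coefCM coefZ coefXn.
  have -> : 'X_i ^+ (n - j) * (('X_i ^+ 2) ^+ j * (k == j)%:R) =
            ('X_i ^+ (n + j)) *+ (k == j) :> {mpoly 'F_2[m]}.
    have -> : (n + j = (n - j) + 2 * j)%N.
      by rewrite mul2n -addnn addnA subnK // -ltnS; exact: ltn_ord.
    by rewrite mulrA -exprM -exprD mulr_natr.
  exact: mulrnAC.
case: (ltnP k n.+1) => [ltk|lek].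
  rewrite (bigD1 (Ordinal ltk)) //= eqxx mulr1n big1 ?addr0 // => j ne.
  rewrite (_ : (k == j) = false) ?mulr0n //.
  by apply: contraNF ne => /eqP e; apply/eqP/val_inj.
rewrite bin_small // mulr0n big1 // => j _.
by rewrite (gtn_eqF (leq_trans (ltn_ord j) lek)).
Qed.

Lemma Sq0 f : Sq 0 f = f.
Proof.
have SqX u : Sq 0 'X_[u] = 'X_[u] :> {mpoly 'F_2[m]}.
  rewrite /Sq tot_SqE mmapX /mmap1 coef0_prod [RHS]mpolyXE_id.
  apply: eq_bigr => i _; elim: (u i) => [|n IH]; first by rewrite !expr0 coef1.
  by rewrite [in LHS]exprS [RHS]exprS coef0M IH coefD coefC coefZ coefX mulr0 addr0.
rewrite [f in LHS]mpolyE linear_sum [RHS]mpolyE; apply: eq_bigr => u _.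
by rewrite linearZ /= SqX.
Qed.

Lemma Sq_homog d k f : f \is d.-homog -> Sq k f \is (d + k).-homog.
Proof.
move=> /dhomogP hf.
pose Q e (P : {poly {mpoly 'F_2[m]}}) := forall k, P`_k \is (e + k).-homog.
have QM e e' P P' : Q e P -> Q e' P' -> Q (e + e')%N (P * P').
  move=> h h' l; rewrite coefM; apply: rpred_sum => i _.
  have := ltn_ord i; rewrite ltnS => le_il.
  have -> : (e + e' + l = (e + i) + (e' + (l - i)))%N.
    by rewrite addnACA subnKC.
  exact: dhomogM.
have Q1 : Q 0%N 1.
  by case=> [|l]; rewrite coef1 /= ?rpred0 // add0n; exact: dhomog1.
have QX i : Q 1%N (('X_i)%:P + ('X_i : {mpoly 'F_2[m]}) ^+ 2 *: 'X).
  move=> l; rewrite coefD coefC coefZ coefX.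
  case: l => [|[|l]] /=; rewrite ?mulr0 ?mulr1 ?add0r ?addr0 ?rpred0 //.
    by rewrite dhomogX /= mdeg1.
  by rewrite mpolyXn dhomogX /= mdegMn mdeg1.
have QXn i n : Q n ((('X_i)%:P + ('X_i : {mpoly 'F_2[m]}) ^+ 2 *: 'X) ^+ n).
  elim: n => [|n IH]; first exact: Q1.
  by rewrite exprS -add1n; exact: QM.
have Qu u : Q (mdeg u) (tot_Sq 'X_[u]).
  rewrite tot_SqE mmapX /mmap1 mdegE.
  elim/big_rec2: _ => [|i e P _ hP]; first exact: Q1.
  exact: QM (QXn _ _) hP.
rewrite [f]mpolyE linear_sum big_seq; apply: rpred_sum => u /hf <-.
by rewrite linearZ; apply: rpredZ; exact: Qu.
Qed.

End SteenrodSquares.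

(* [dhomog] is already a [vectType] when the number of variables is a
   successor; this alias makes it one for every m. *)
Definition homog_poly (m d : nat) : Type := dhomog m 'F_2 d.

HB.instance Definition _ m d := GRing.Lmodule.on (homog_poly m d).

Fact homog_poly_vecaxiom m d :
  vector_axiom 'C((d + m).-1, d) (homog_poly m d).
Proof.
case: m => [|m]; last by rewrite addnS; exact: dhomog_vecaxiom.
rewrite addn0.
pose f (p : homog_poly 0 d) : 'rV['F_2]_('C(d.-1, d)) :=
  \row_i (mpoly_of_dhomog p)@_0%MM.
pose g (r : 'rV['F_2]_('C(d.-1, d))) : homog_poly 0 d :=
  indhomog d (\sum_i r 0 i)%:MP.
have m0 (u : 'X_{1..0}) : u = 0%MM by apply/mnmP; case.
have noI e : 'I_('C(e.+1.-1, e.+1)) -> False.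
  by case=> i; rewrite bin_small.
have gE r : mpoly_of_dhomog (g r) = (\sum_i r 0 i)%:MP.
  rewrite /g /indhomog insubdK //= -topredE /=.
  case: d {f g} r => [|d] r.
    by rewrite dhomogE msuppC; case: eqP => //= _; rewrite mdeg0.
  by rewrite big1 ?rpred0 // => i _; case: (noI _ i).
exists f => [c p q|]; first by apply/rowP=> i; rewrite !mxE /= mcoeffD mcoeffZ.
exists g.
  move=> p; apply/val_inj/mpolyP=> u /=; rewrite [u]m0 gE mcoeffC eqxx mulr1.
  rewrite (eq_bigr (fun=> (mpoly_of_dhomog p)@_0%MM)) => [|i _]; last first.
    by rewrite mxE.
  rewrite sumr_const card_ord.
  case: d p {f g gE} => [|d] p; first by rewrite bin0.
  rewrite bin_small // mulr0n; apply/esym/(@dhomog_nemf_coeff _ _ mdeg d.+1).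
    exact: dhomog_is_dhomog.
  by rewrite /= mdeg0.
move=> r; apply/rowP=> i; rewrite mxE gE mcoeffC eqxx mulr1.
case: d r i {f g gE} => [|d] r i; last by case: (noI _ i).
have e1 j : j = i by apply: val_inj; case: i j => [[|i]] // ? [[|j]] //.
rewrite (eq_bigr (fun=> r 0 i)) => [|j _]; last by rewrite (e1 j).
by rewrite sumr_const card_ord; exact: mulr1n.
Qed.

HB.instance Definition _ m d :=
  Lmodule_hasFinDim.Build 'F_2 (homog_poly m d) (homog_poly_vecaxiom m d).

(* [to_homog d f] is f if f is homogeneous of degree d (and 0 otherwise). *)
Definition to_homog (m d : nat) (f : {mpoly 'F_2[m]}) : homog_poly m d :=
  indhomog d f.

(* Indices start at 0: the entry [p i] is the (i+1)-st entry of the vector. *)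
Definition param_vector := {fsfun nat -> nat with 0%N}.

Definition deg_param (p : param_vector) : nat :=
  (\sum_(i <- finsupp p) 2 ^ i * p i)%N.

Definition bin_digit (t n : nat) : nat := odd (n %/ 2 ^ t).

(* The binary digits of index at least mdeg u of the exponents all vanish,
   see [Param_monomE]. *)
Definition Param_monom (m : nat) (u : 'X_{1..m}) : param_vector :=
  [fsfun i in [fset (val j) | j in 'I_(mdeg u)]%fset =>
     (\sum_(j < m) bin_digit i (u j))%N].

(* Left lexicographic order; at the first index where p and q differ, p < q
   forces that index to be in the support of q. *)
Definition param_lt (p q : param_vector) : bool :=
  has (fun i => (p i < q i)%N && all (fun j => p j == q j) (iota 0 i))
      (finsupp q).

Definition param_le (p q : param_vector) : bool := (p == q) || param_lt p q.

Lemma Param_monomE m (u : 'X_{1..m}) i :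
  Param_monom u i = (\sum_(j < m) bin_digit i (u j))%N.
Proof.
rewrite fsfunE; case: ifPn => // /negP ni; rewrite big1 // => j _.
rewrite /bin_digit divn_small //; apply: leq_ltn_trans (ltn_expl i (ltnSn 1)).
apply: leq_trans (_ : (mdeg u <= i)%N).
  by rewrite mdegE (bigD1 j) //= leq_addr.
rewrite leqNgt; apply/negP => lt; apply: ni.
by apply/imfsetP; exists (Ordinal lt).
Qed.

Lemma param_ltP (p q : param_vector) :
  reflect (exists i, (p i < q i)%N /\ forall j, (j < i)%N -> p j = q j)
          (param_lt p q).
Proof.
apply: (iffP hasP) => [[i _ /andP[lt /allP h]]|[i [lt h]]]; exists i => //.
  by split=> // j ltj; apply/eqP/h; rewrite mem_iota.
  by rewrite mem_finsupp; case: (q i) lt.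
rewrite lt; apply/allP => j; rewrite mem_iota => ltj.
by apply/eqP/h.
Qed.

(* The degree d part of the hit submodule, see [hit_degP]. *)
Definition hit_deg (m d : nat) : {vspace homog_poly m d} :=
  <<[seq to_homog d (Sq (d - mdeg u) 'X_[u]) | u : 'X_{1..m < d}]>>%VS.

Definition poly_le (m : nat) (p : param_vector) :
    {vspace homog_poly m (deg_param p)} :=
  <<[seq to_homog (deg_param p) 'X_[u]
      | u : 'X_{1..m < (deg_param p).+1} in
        [pred u : 'X_{1..m < _} | (mdeg u == deg_param p) && param_le (Param_monom u) p]]>>%VS.

Definition poly_lt (m : nat) (p : param_vector) :
    {vspace homog_poly m (deg_param p)} :=
  <<[seq to_homog (deg_param p) 'X_[u]
      | u : 'X_{1..m < (deg_param p).+1} in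
        [pred u : 'X_{1..m < _} | (mdeg u == deg_param p) && param_lt (Param_monom u) p]]>>%VS.

Definition sim_zero (m : nat) (p : param_vector) :
    {vspace homog_poly m (deg_param p)} :=
  ((hit_deg m (deg_param p) :&: poly_le m p) + poly_lt m p)%VS.

(* Dimension of the quotient of [poly_le m p] by its subspace [sim_zero m p]
   (see [sim_zero_sub]). *)
Definition dim_Q (m : nat) (p : param_vector) : nat :=
  (\dim (poly_le m p) - \dim (sim_zero m p))%N.

Lemma sim_zero_sub m p : (sim_zero m p <= poly_le m p)%VS.
Proof.
rewrite subv_add capvSr /=; apply: sub_span => v /imageP[u].
rewrite inE => /andP[e lt] ->; apply: image_f.
by rewrite inE e /param_le lt orbT.
Qed.

(* On [poly_le m p], being equivalent to 0 modulo [sim_zero] is the same as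
   lying in the sum of the hit polynomials and [poly_lt m p]. *)
Lemma sim_zeroE m p f : f \in poly_le m p ->
  (f \in sim_zero m p) = (f \in hit_deg m (deg_param p) + poly_lt m p)%VS.
Proof.
move=> fle; apply/idP/idP => [|/memv_addP[h hh [l hl fE]]].
  by apply/subvP/addvS => //; exact: capvSl.
rewrite fE; apply: memv_add => //; rewrite memv_cap hh /=.
have -> : h = f - l by rewrite fE addrK.
apply: memvB => //; apply: (subvP (sim_zero_sub m p)).
by apply: (subvP (addvSr _ _)).
Qed.

Lemma to_homogE m d (f : {mpoly 'F_2[m]}) :
  f \is d.-homog -> mpoly_of_dhomog (to_homog d f) = f.
Proof. by move=> h; exact: (insubdK (0 : dhomog m 'F_2 d) h). Qed.

Lemma hit_degP m d (f : homog_poly m d) :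
  f \in hit_deg m d <-> hit (mpoly_of_dhomog f).
Proof.
split=> [fin|[s [/allP hs fE]]].
  have hit0 : @hit m 0 by exists [::]; rewrite big_nil.
  have hitD (g h : {mpoly 'F_2[m]}) : hit g -> hit h -> hit (g + h).
    move=> [s [hs ->]] [t [ht ->]]; exists (s ++ t).
    by rewrite all_cat hs ht big_cat.
  have hitZ (c : 'F_2) (g : {mpoly 'F_2[m]}) : hit g -> hit (c *: g).
    move=> hg; have [->|nz] := eqVneq c 0; first by rewrite scale0r.
    suff -> : c = 1 by rewrite scale1r.
    by apply: val_inj; case: c nz => -[|[|?]].
  rewrite (coord_span fin) (big_morph (@mpoly_of_dhomog m _ d)
    (id1 := 0) (op1 := +%R)) //.
  apply: (big_ind (@hit m)) => // i _.
  apply: (hitZ _ (mpoly_of_dhomog _)).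
  rewrite -tnth_nth; set v := tnth _ i.
  have /imageP[u _ ->] : v \in [seq to_homog d (Sq (d - mdeg u) 'X_[u])
                                 | u : 'X_{1..m < d}] by exact: mem_tnth.
  have lu : (mdeg u < d)%N by exact: bmdeg.
  rewrite to_homogE; last first.
    have hX : ('X_[u] : {mpoly 'F_2[m]}) \is (mdeg u).-homog by rewrite dhomogX /=.
    by have := Sq_homog (d - mdeg u) hX; rewrite subnKC ?(ltnW lu).
  exists [:: ([:: d - mdeg u]%N, 'X_[u])]; split.
    by rewrite /= addn0 subn_gt0 lu.
  by rewrite big_seq1.
have key (w : seq nat) (g : {mpoly 'F_2[m]}) : (0 < sumn w)%N ->
    to_homog d (pihomog mdeg d (Sq_word w g)) \in hit_deg m d.
  elim: w => // k w IH /=; case: k => [|k]; first by rewrite Sq0.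
  move=> _; move: (Sq_word w g) => h {IH}.
  have lin (I : seq 'X_{1..m}) (G : 'X_{1..m} -> {mpoly 'F_2[m]}) :
      (forall u, G u \is d.-homog) ->
      to_homog d (\sum_(u <- I) G u) = \sum_(u <- I) to_homog d (G u).
    move=> hG; apply: val_inj => /=; rewrite to_homogE ?rpred_sum //.
    rewrite (big_morph (@mpoly_of_dhomog m _ d) (id1 := 0) (op1 := +%R)) //.
    by apply: eq_bigr => u _; rewrite to_homogE.
  rewrite [h]mpolyE !linear_sum lin => [|u]; last exact: pihomogP.
  apply: memv_suml => u _; rewrite !linearZ /=.
  have -> : to_homog d (h@_u *: pihomog mdeg d (Sq k.+1 'X_[u])) =
      h@_u *: to_homog d (pihomog mdeg d (Sq k.+1 'X_[u])).
    by apply: val_inj; rewrite /= !to_homogE ?rpredZ ?pihomogP.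
  apply: memvZ; have hX : Sq k.+1 'X_[u] \is (mdeg u + k.+1).-homog for mdeg.
    by apply: (@Sq_homog m); rewrite dhomogX /=.
  have [e|ne] := eqVneq (mdeg u + k.+1)%N d; last first.
    rewrite (pihomog_ne0 ne hX).
    have -> : to_homog d 0 = 0 :> homog_poly m d.
      by apply: val_inj; rewrite /= to_homogE ?rpred0.
    exact: mem0v.
  rewrite pihomog_dE -?e //; apply: memv_span.
  have lu : (mdeg u < mdeg u + k.+1)%N by rewrite addnS ltnS leq_addr.
  apply/mapP; exists (BMultinom lu); rewrite ?mem_enum //=.
  by rewrite addKn.
have -> : f = \sum_(wg <- s) to_homog d (pihomog mdeg d (Sq_word wg.1 wg.2)).
  apply: val_inj => /=.
  rewrite (big_morph (@mpoly_of_dhomog m _ d) (id1 := 0) (op1 := +%R)) //.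
  rewrite -[LHS](pihomog_dE (dhomog_is_dhomog f)) /= fE linear_sum.
  by apply: eq_bigr => wg _; rewrite to_homogE ?pihomogP.
by rewrite big_seq; apply: memv_suml => wg /hs; exact: key.
Qed.

(* Main.v *)
Require Import Defs.
From mathcomp Require Import all_boot all_order all_algebra.
From mathcomp Require Import finmap.
From mathcomp.multinomials Require Import mpoly.
From mathcomp Require Import zify ring.

Set Implicit Arguments.
Unset Strict Implicit.
Unset Printing Implicit Defensive.

(* Three facts bound the quotient, where [z_T] denotes the product of the
   [x_j] with [j] in [T].
   - The map f |-> z_T f^2 sends hit polynomials to hit polynomials modulo
     monomials with fewer than [#|T|] odd exponents, so prepending r to a
     parameter vector multiplies the dimension by at most 'C(m, r).
   - z_T f^2 with f of degree k is congruent, modulo hits, to f times the image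
     of z_T under the conjugate of Sq^k, and that image vanishes unless k + r is
     a sum of r = #|T| powers of 2.
   - Sq^1 (z_A z_B^2 g^4), with #|A| = r + 1 and #|B| = r - 1, is a relation
     between the monomials z_S z_T^2 g^4; these relations let one exchange
     elements between S and T and leave only 'C('C(m, r) + 1, 2) of the pairs
     (S, T).
   In degree n_s with s >= 2, the second fact leaves only the first entry 5 and
   so reduces to degree n_(s-1).  In degree 18 counting monomials suffices.  In
   degree 41 the dangerous vectors start with 1, (3, 1) or (3, 3): the second
   fact kills the first two kinds, and the third bounds the last one by
   55 * 150, where 150 comes from degree 8 and itself uses the third fact for the
   vector (1, 1). *)

(** * Parameter vectors and hit polynomials *)

Section Quotient.
Import GRing.Theory.
Local Open Scope ring_scope.

Variable m : nat.
Implicit Types (f g h : {mpoly 'F_2[m]}) (u v w : 'X_{1..m}) (T : {set 'I_m}).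

Definition par u i : nat := (\sum_(j < m) bin_digit i (u j))%N.

Definition ind_mnm T : 'X_{1..m} := [multinom (j \in T : nat) | j < m].

Definition odd_part u : {set 'I_m} := [set j | odd (u j)].

Definition half_mnm u : 'X_{1..m} := [multinom (u j)./2 | j < m].

(** Splitting off the lowest binary digit of every exponent writes each monomial as z_T f^2 with f a
    monomial. On parameter vectors this removes the head, which is what makes induction on the list
    of entries possible. *)
Lemma mnm_halfE u : u = (ind_mnm (odd_part u) + half_mnm u *+ 2)%MM.
Proof.
apply/mnmP => j; rewrite mnmDE mulmnE !mnmE inE.
by rewrite muln2 odd_double_half.
Qed.

Lemma bin_digit0 n : bin_digit 0 n = odd n.
Proof. by rewrite /bin_digit expn0 divn1. Qed.

Lemma bin_digitS i n : bin_digit i.+1 n = bin_digit i n./2.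
Proof. by rewrite /bin_digit expnS divnMA divn2. Qed.

Lemma par_dbl0 u v : par (u + v *+ 2)%MM 0 = par u 0.
Proof.
apply: eq_bigr => j _; rewrite !bin_digit0 mnmDE mulmnE.
by rewrite oddD oddM andbF addbF.
Qed.

Lemma par_ind0 T v : par (ind_mnm T + v *+ 2)%MM 0 = #|T|.
Proof.
rewrite par_dbl0 -sum1_card [RHS]big_mkcond; apply: eq_bigr => j _.
by rewrite bin_digit0 mnmE; case: (j \in T).
Qed.

Lemma par_indS T v i : par (ind_mnm T + v *+ 2)%MM i.+1 = par v i.
Proof.
apply: eq_bigr => j _; rewrite bin_digitS mnmDE mulmnE mnmE.
by rewrite muln2 half_bit_double.
Qed.

Lemma par0E u : par u 0 = #|odd_part u|.
Proof. by rewrite [in LHS](mnm_halfE u) par_ind0. Qed.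

Lemma parSE u i : par u i.+1 = par (half_mnm u) i.
Proof. by rewrite [in LHS](mnm_halfE u) par_indS. Qed.

Lemma par0D u v : (par (u + v)%MM 0 <= par u 0 + par v 0)%N.
Proof.
rewrite -big_split /=; apply: leq_sum => j _; rewrite !bin_digit0 mnmDE oddD.
by case: (odd _); case: (odd _).
Qed.

Lemma par0U j : par U_(j)%MM 0 = 1%N.
Proof.
rewrite /par (bigD1 j) //= bin_digit0 mnm1E eqxx big1 // => i ne.
by rewrite bin_digit0 mnm1E eq_sym (negPf ne).
Qed.

Fixpoint degs (ps : seq nat) : nat := if ps is r :: ps' then r + 2 * degs ps' else 0.

(** A list stands for the vector obtained by padding it with zeros, so trailing zeros do not
    matter. *)
Definition has_par (ps : seq nat) u := forall i, par u i = nth 0%N ps i.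

Lemma has_par_cons r ps T v :
  #|T| = r -> has_par ps v -> has_par (r :: ps) (ind_mnm T + v *+ 2)%MM.
Proof. by move=> cT hv [|i]; rewrite ?par_ind0 ?par_indS //= hv. Qed.

Lemma has_par_inv r ps u :
  has_par (r :: ps) u -> #|odd_part u| = r /\ has_par ps (half_mnm u).
Proof. by move=> hu; split=> [|i]; rewrite -?par0E -?parSE hu. Qed.

Lemma mdeg_halfE u : mdeg u = (#|odd_part u| + 2 * mdeg (half_mnm u))%N.
Proof.
rewrite [in LHS](mnm_halfE u) mdegD mdegMn mulnC; congr addn.
rewrite mdegE -sum1_card [RHS]big_mkcond; apply: eq_bigr => j _.
by rewrite mnmE; case: (j \in _).
Qed.

Lemma has_par_nil u : has_par [::] u -> u = 0%MM.
Proof.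
elim: (mdeg u) {-2}u (leqnn (mdeg u)) => [|d IH] {}u.
  by rewrite leqn0 mdeg_eq0 => /eqP.
move=> led hu; have hh : has_par [::] (half_mnm u).
  by move=> i; rewrite -parSE hu !nth_nil.
have o0 : #|odd_part u| = 0%N by rewrite -par0E hu.
have [z|nz] := eqVneq (mdeg u) 0%N; first by apply/eqP; rewrite -mdeg_eq0 z.
have h0 : half_mnm u = 0%MM by apply: IH hh; have := mdeg_halfE u; lia.
apply/eqP; rewrite -mdeg_eq0 mdeg_halfE o0 h0 mdeg0 //.
Qed.

Lemma mdeg_degs ps u : has_par ps u -> mdeg u = degs ps.
Proof.
elim: ps u => [|r ps IH] u hu; first by rewrite (has_par_nil hu) mdeg0.
by have [<- /IH h] := has_par_inv hu; rewrite mdeg_halfE h.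
Qed.

(** * Supports, characteristic 2 and hit polynomials *)

Definition msub (D : 'X_{1..m} -> Prop) f := forall u, u \in msupp f -> D u.

Lemma msub0 D : msub D 0.
Proof. by move=> u; rewrite msupp0. Qed.

Lemma msubD D f g : msub D f -> msub D g -> msub D (f + g).
Proof. by move=> hf hg u /msuppD_le; rewrite mem_cat => /orP[/hf|/hg]. Qed.

Lemma msubX D u : D u -> msub D 'X_[u].
Proof. by move=> hu v; rewrite msuppX inE => /eqP ->. Qed.

Lemma msub_sum D (I : Type) (s : seq I) (P : pred I) (F : I -> {mpoly 'F_2[m]}) :
  (forall i, P i -> msub D (F i)) -> msub D (\sum_(i <- s | P i) F i).
Proof. by move=> h; elim/big_ind: _ => //; [exact: msub0 | exact: msubD]. Qed.

Lemma msubM (D1 D2 D : 'X_{1..m} -> Prop) f g : msub D1 f -> msub D2 g ->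
  (forall u v, D1 u -> D2 v -> D (u + v)%MM) -> msub D (f * g).
Proof.
move=> hf hg h u /msuppM_le /allpairsP[[a b] /= [/hf ha /hg hb ->]]; exact: h.
Qed.

Lemma F2_01 (c : 'F_2) : c = 0 \/ c = 1.
Proof. by case: c => -[|[|?]] // ?; [left|right]; apply/val_inj. Qed.

Lemma pchar2_mpoly : 2%N \in [pchar {mpoly 'F_2[m]}].
Proof.
apply/andP; split=> //; apply/eqP/mpolyP => u.
rewrite mcoeffMn mcoeff0; exact: (mulrn_pchar (pchar_Fp (erefl (prime 2)))).
Qed.

Lemma mpoly_dbl f : f + f = 0.
Proof. exact: (addrr_pchar2 pchar2_mpoly). Qed.

Lemma sqrD2 f g : (f + g) ^+ 2 = f ^+ 2 + g ^+ 2.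
Proof. by rewrite sqrrD mulr2n mpoly_dbl addr0. Qed.

Lemma sqr_sum2 (I : Type) (s : seq I) (P : pred I) (F : I -> {mpoly 'F_2[m]}) :
  (\sum_(i <- s | P i) F i) ^+ 2 = \sum_(i <- s | P i) F i ^+ 2.
Proof.
apply: (big_morph (fun f => f ^+ 2)); first exact: sqrD2.
by rewrite expr0n.
Qed.

Lemma mpolyE1 f : f = \sum_(u <- msupp f) 'X_[u].
Proof.
rewrite [LHS]mpolyE; apply: eq_big_seq => u; rewrite mcoeff_msupp.
by case: (F2_01 f@_u) => ->; rewrite ?eqxx // scale1r.
Qed.

Lemma msub_sqr (D : 'X_{1..m} -> Prop) f :
  (forall u, u \in msupp f -> D (u *+ 2)%MM) -> msub D (f ^+ 2).
Proof.
move=> h; rewrite [f]mpolyE1 sqr_sum2 big_seq; apply: msub_sum => u uf.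
by rewrite mpolyXn; apply: msubX; exact: h.
Qed.

Lemma mpolyX_ind T : 'X_[ind_mnm T] = \prod_(j in T) 'X_j :> {mpoly 'F_2[m]}.
Proof.
rewrite mpolyXE_id [RHS]big_mkcond; apply: eq_bigr => j _; rewrite mnmE.
by case: (j \in T); rewrite ?expr1 ?expr0.
Qed.

Lemma hit0 : @hit m 0.
Proof. by exists [::]; rewrite big_nil. Qed.

Lemma hitD f g : hit f -> hit g -> hit (f + g).
Proof.
move=> [s [hs ->]] [t [ht ->]]; exists (s ++ t).
by rewrite all_cat hs ht big_cat.
Qed.

Lemma hit_sum (I : Type) (s : seq I) (P : pred I) (F : I -> {mpoly 'F_2[m]}) :
  (forall i, P i -> hit (F i)) -> hit (\sum_(i <- s | P i) F i).
Proof. by move=> h; elim/big_ind: _ => //; [exact: hit0 | exact: hitD]. Qed.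

Lemma hit_Sq k f : (0 < k)%N -> hit (Sq k f).
Proof.
by move=> k0; exists [:: ([:: k], f)]; rewrite /= addn0 k0 big_seq1.
Qed.

(** Once its leading Sq^0 are dropped, a word of positive degree begins with some Sq^(k+1), so sums
    of values of single squares give all hit polynomials. *)
Lemma hit_ind (Q : {mpoly 'F_2[m]} -> Prop) : Q 0 ->
  (forall f g, Q f -> Q g -> Q (f + g)) -> (forall k f, Q (Sq k.+1 f)) ->
  forall f, hit f -> Q f.
Proof.
move=> Q0 QD QS f [s [hs ->]]; elim: s hs => [|[w g] s IH] /=.
  by rewrite big_nil.
move=> /andP[hw /IH hs]; rewrite big_cons; apply: QD => //= {s IH hs}.
by elim: w hw => [|[|k] w IH] //= hw; rewrite Sq0; apply: IH.
Qed.

Definition lexlt (p q : nat -> nat) :=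
  exists i, (p i < q i)%N /\ forall j, (j < i)%N -> p j = q j.

(** No condition is put on the degree of u; [dim_Q_le] restores it by projecting to one homogeneous
    component. *)
Definition lower ps u := lexlt (par u) (nth 0%N ps).

Lemma lower0 r ps u : (par u 0 < r)%N -> lower (r :: ps) u.
Proof. by exists 0%N. Qed.

Lemma lowerS r ps T v : #|T| = r -> lower ps v ->
  lower (r :: ps) (ind_mnm T + v *+ 2)%MM.
Proof.
move=> cT [i [lt eq]]; exists i.+1; rewrite par_indS; split=> //.
by case=> [|j] ltj; rewrite ?par_ind0 ?par_indS //= eq.
Qed.

Definition triv ps f := exists h l, [/\ hit h, msub (lower ps) l & f = h + l].

Lemma hit_triv ps f : hit f -> triv ps f.
Proof. by exists f, 0; split=> //; [exact: msub0 | rewrite addr0]. Qed.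

Lemma lower_triv ps f : msub (lower ps) f -> triv ps f.
Proof. by exists 0, f; split=> //; [exact: hit0 | rewrite add0r]. Qed.

Lemma trivD ps f g : triv ps f -> triv ps g -> triv ps (f + g).
Proof.
move=> [h [l [hh hl ->]]] [h' [l' [hh' hl' ->]]].
by exists (h + h'), (l + l'); split; [exact: hitD|exact: msubD|rewrite addrACA].
Qed.

Lemma triv0 ps : triv ps 0.
Proof. exact: hit_triv hit0. Qed.

(** * The map f |-> z_T f^2 *)

Lemma tot_Sq_prod (I : Type) (s : seq I) (P : pred I) (F : I -> {mpoly 'F_2[m]}) :
  tot_Sq (\prod_(i <- s | P i) F i) = \prod_(i <- s | P i) tot_Sq (F i).
Proof.
apply: (big_morph (@tot_Sq m)) => [f g|]; first exact: tot_SqM.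
by rewrite tot_SqE rmorph1.
Qed.

Lemma pchar2_poly : 2%N \in [pchar {poly {mpoly 'F_2[m]}}].
Proof. exact: (rmorph_pchar (@polyC {mpoly 'F_2[m]}) pchar2_mpoly). Qed.

(** Squaring is additive in characteristic 2. This is the induction step showing that every
    coefficient of a square is itself a square. *)
Lemma sqr_polyS (P : {poly {mpoly 'F_2[m]}}) c k :
  ((P * 'X + c%:P) ^+ 2)`_k.+2 = (P ^+ 2)`_k.
Proof.
rewrite sqrrD mulr2n (addrr_pchar2 pchar2_poly) addr0 exprMn -rmorphXn /=.
by rewrite coefD coefMXn coefC addr0 /= subn2.
Qed.

Lemma sqr_poly (P : {poly {mpoly 'F_2[m]}}) k :
  (P ^+ 2)`_(2 * k) = P`_k ^+ 2.
Proof.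
elim/poly_ind: P k => [|P c IH] [|k]; rewrite ?expr0n ?coef0 ?expr0n //.
  by rewrite muln0 expr2 coef0M.
by rewrite mulnS add2n sqr_polyS IH coefD coefMX coefC /= addr0.
Qed.

Lemma sqr_poly_sqr (P : {poly {mpoly 'F_2[m]}}) k :
  exists f, (P ^+ 2)`_k = f ^+ 2.
Proof.
elim/poly_ind: P k => [|P c IH] k; first by exists 0; rewrite !expr0n coef0.
case: k => [|[|k]]; last by rewrite sqr_polyS.
  by exists (P * 'X + c%:P)`_0; rewrite !expr2 coef0M.
exists 0; rewrite expr0n expr2 coefM big_ord_recl big_ord1 /=.
by rewrite mulrC mpoly_dbl.
Qed.

(** Each factor contributes x_j or x_j^2 'X, so every unit of k turns some x_j into a square, which
    adds no odd exponent. Repetitions in s only lower the number of odd exponents. *)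
Lemma Sq_prod_par0 (s : seq 'I_m) k :
  msub (fun u => (par u 0 + k <= size s)%N) (Sq k (\prod_(j <- s) 'X_j)).
Proof.
rewrite /Sq tot_Sq_prod; elim: s k => [|j s IH] k.
  rewrite big_nil coef1; case: k => [|k]; last exact: msub0.
  rewrite -mpolyX0; apply: msubX; rewrite addn0 /par big1 // => j _.
  by rewrite bin_digit0 mnm0E.
rewrite big_cons tot_SqX mulrDl coefD coefCM; apply: msubD.
  apply: (msubM (D1 := eq U_(j)%MM) _ (IH k)); first exact: msubX.
  move=> _ v <- /=; have := par0D U_(j)%MM v; rewrite par0U; lia.
rewrite -scalerAl coefZ coefXM; case: k => [|k] /=; first by rewrite mulr0; exact: msub0.
apply: (msubM (D1 := eq (U_(j) *+ 2)%MM) _ (IH k)).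
  by rewrite mpolyXn; exact: msubX.
by move=> _ v <- /=; rewrite addmC par_dbl0; lia.
Qed.

(** By the Cartan formula, z (Sq^k g)^2 differs from Sq^(2k) (z g^2) by terms Sq^i z times a square
    with i > 0. Such terms have at most r - i odd exponents, hence are lower already at the first
    entry. *)
Lemma triv_mul r ps T f : #|T| = r -> triv ps f ->
  triv (r :: ps) ('X_[ind_mnm T] * f ^+ 2).
Proof.
move=> cT [h [l [hh hl ->]]]; rewrite sqrD2 mulrDr; apply: trivD; last first.
  apply: lower_triv; apply: (msubM (D1 := eq (ind_mnm T))
    (D2 := fun u => exists2 v, lower ps v & u = (v *+ 2)%MM)).
  - exact: msubX.
  - by apply: msub_sqr => u /hl hu; exists u.
  - by move=> _ _ <- [v hv ->]; exact: lowerS.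
elim/hit_ind: h / hh => [|f1 f2 h1 h2|k g].
- by rewrite expr0n mulr0; exact: triv0.
- by rewrite sqrD2 mulrDr; exact: trivD.
set z := 'X_[ind_mnm T].
have -> : z * Sq k.+1 g ^+ 2 = Sq (2 * k.+1) (z * g ^+ 2) +
    \sum_(i < (2 * k.+1).+1 | i != ord0) Sq i z * Sq (2 * k.+1 - i) (g ^+ 2).
  rewrite Sq_cartan (bigD1 ord0) //= -addrA mpoly_dbl addr0 Sq0 subn0.
  by rewrite /Sq tot_SqXn sqr_poly.
apply: trivD; first by apply: hit_triv; exact: hit_Sq.
apply: lower_triv; apply: msub_sum => i; rewrite -lt0n => i0.
have hz : msub (fun u => (par u 0 + i <= r)%N) (Sq i z).
  rewrite /z mpolyX_ind -cT.
  have -> : \prod_(j in T) 'X_j = \prod_(j <- enum T) 'X_j :> {mpoly 'F_2[m]}.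
    by rewrite big_enum.
  by rewrite cardE; exact: Sq_prod_par0.
have [g' ->] : exists f, Sq (2 * k.+1 - i) (g ^+ 2) = f ^+ 2.
  by rewrite /Sq tot_SqXn; exact: sqr_poly_sqr.
apply: (msubM (D2 := fun u => exists v, u = (v *+ 2)%MM) hz).
  by apply: msub_sqr => u _; exists u.
move=> u _ hu [v ->]; apply: lower0; rewrite par_dbl0; apply: leq_trans hu.
by rewrite -addn1 leq_add2l.
Qed.

(** * Spanning sets of the quotient *)

(* In characteristic 2, [f + sum] stands for the difference. *)
Definition gen ps (L : seq 'X_{1..m}) f :=
  exists s, {subset s <= L} /\ triv ps (f + \sum_(v <- s) 'X_[v]).

Lemma gen_mem ps L v : v \in L -> gen ps L 'X_[v].
Proof.
move=> vL; exists [:: v]; split=> [w|]; first by rewrite inE => /eqP ->.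
by rewrite big_seq1 mpoly_dbl; exact: triv0.
Qed.

Lemma gen_triv ps L f g : triv ps (f + g) -> gen ps L g -> gen ps L f.
Proof.
move=> h [s [sL hs]]; exists s; split=> //.
have -> : f + \sum_(v <- s) 'X_[v] = (f + g) + (g + \sum_(v <- s) 'X_[v]).
  by rewrite addrA -(addrA f g g) mpoly_dbl addr0.
exact: trivD.
Qed.

Lemma gen_sum ps L (I : Type) (s : seq I) (P : pred I) (F : I -> {mpoly 'F_2[m]}) :
  (forall i, P i -> gen ps L (F i)) -> gen ps L (\sum_(i <- s | P i) F i).
Proof.
move=> h; elim/big_ind: _ => // [|f g [s1 [h1 t1]] [s2 [h2 t2]]].
  by exists [::]; rewrite big_nil addr0; split=> //; exact: triv0.
exists (s1 ++ s2); split=> [v|]; first by rewrite mem_cat => /orP[/h1|/h2].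
by rewrite big_cat /= addrACA; exact: trivD.
Qed.

Lemma gen_trans ps L L' f : gen ps L f ->
  (forall v, v \in L -> gen ps L' 'X_[v]) -> gen ps L' f.
Proof.
move=> [s [sL ts]] h; apply: gen_triv ts _; rewrite big_seq.
by apply: gen_sum => v /sL /h.
Qed.

Lemma Xmul T v : 'X_[(ind_mnm T + v *+ 2)%MM] = 'X_[ind_mnm T] * 'X_[v] ^+ 2 :> {mpoly 'F_2[m]}.
Proof. by rewrite mpolyXD mpolyXn. Qed.

Lemma gen_mul r ps L T f : #|T| = r -> gen ps L f ->
  gen (r :: ps) [seq (ind_mnm T + v *+ 2)%MM | v <- L] ('X_[ind_mnm T] * f ^+ 2).
Proof.
move=> cT [s [sL ts]]; exists [seq (ind_mnm T + v *+ 2)%MM | v <- s]; split.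
  by move=> _ /mapP[v /sL vL ->]; exact: map_f.
rewrite big_map (eq_bigr (fun v => 'X_[ind_mnm T] * 'X_[v] ^+ 2)) => [|v _].
  by rewrite -mulr_sumr -sqr_sum2 -mulrDr -sqrD2; exact: triv_mul.
exact: Xmul.
Qed.

(** The generators themselves must have vector ps: this fixes their degree and lets the exchange
    relations be applied above them. *)
Definition Qdim_le ps N := exists L : seq 'X_{1..m},
  [/\ (size L <= N)%N, forall v, v \in L -> has_par ps v
    & forall u, has_par ps u -> gen ps L 'X_[u]].

Lemma Qdim_leW ps N N' : (N <= N')%N -> Qdim_le ps N -> Qdim_le ps N'.
Proof. by move=> le [L [sL h1 h2]]; exists L; split=> //; exact: leq_trans le. Qed.

Lemma Qdim_degs0 ps : degs ps = 0%N -> Qdim_le ps 1.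
Proof.
move=> d0; exists [:: 0%MM]; split=> // [v|u].
  rewrite inE => /eqP -> i; rewrite /par big1 => [|j _]; last first.
    by rewrite mnm0E /bin_digit div0n.
  elim: ps d0 i => [|r ps IH] /=; first by move=> _ i; rewrite nth_nil.
  move=> d0; have [-> /IH h] : r = 0%N /\ degs ps = 0%N by lia.
  by case.
move=> /mdeg_degs; rewrite d0 => /eqP; rewrite mdeg_eq0 => /eqP ->.
by apply: gen_mem; rewrite inE.
Qed.

Lemma Qdim_cons r ps N : Qdim_le ps N -> Qdim_le (r :: ps) ('C(m, r) * N).
Proof.
move=> [L [sL hL gL]].
pose D := enum [set T : {set 'I_m} | #|T| == r].
exists [seq (ind_mnm T + v *+ 2)%MM | T <- D, v <- L]; split.
- by rewrite size_allpairs -cardE card_draws card_ord leq_mul2l sL orbT.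
- move=> _ /allpairsP[[T v] /= [TD vL ->]]; apply: has_par_cons (hL _ vL).
  by move: TD; rewrite mem_enum inE => /eqP.
move=> u /has_par_inv[cT /gL gu]; rewrite (mnm_halfE u) Xmul.
apply: gen_trans (gen_mul cT gu) _ => _ /mapP[v vL ->]; apply: gen_mem.
by apply: allpairs_f => //; rewrite mem_enum inE cT.
Qed.

Lemma Qdim_ex ps : exists N, Qdim_le ps N.
Proof.
elim: ps => [|r ps [N hN]]; first by exists 1%N; exact: Qdim_degs0.
by eexists; apply: Qdim_cons hN.
Qed.

(** No T has r > m elements, so 'C(m, r) = 0; [Qdim_ex] supplies a finite bound for this factor to
    annihilate. *)
Lemma Qdim_big r ps : (m < r)%N -> Qdim_le (r :: ps) 0.
Proof.
move=> lt; have [N /(Qdim_cons r)] := Qdim_ex ps.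
by rewrite bin_small.
Qed.

(** * The conjugate total square *)

Definition pow2_sum r n := exists e : seq nat, size e = r /\ n = (\sum_(i <- e) 2 ^ i)%N.

Notation MP := {mpoly 'F_2[m]}.

Definition tot : {rmorphism MP -> {poly MP}} :=
  mmap (@polyC MP \o @mpolyC m 'F_2) (fun i => ('X_i)%:P + 'X_i ^+ 2 *: 'X).

(* The total square, applied to polynomials graded by the same marker 'X. *)
Definition Tot (P : {poly MP}) : {poly MP} := (map_poly tot P).['X].

Lemma TotM P R : Tot (P * R) = Tot P * Tot R.
Proof. by rewrite /Tot rmorphM hornerM. Qed.

Lemma TotC f : Tot f%:P = tot_Sq f.
Proof. by rewrite /Tot map_polyC hornerC. Qed.

Lemma TotX : Tot 'X = 'X.
Proof. by rewrite /Tot map_polyX hornerX. Qed.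

Lemma TotD P R : Tot (P + R) = Tot P + Tot R.
Proof. by rewrite /Tot rmorphD hornerD. Qed.

Lemma TotXn P k : Tot (P ^+ k) = Tot P ^+ k.
Proof. by rewrite /Tot rmorphXn horner_exp. Qed.

Lemma coef_Tot P k : (Tot P)`_k = \sum_(i < k.+1) Sq (k - i) P`_i.
Proof.
elim/poly_ind: P k => [|P c IH] k.
  rewrite -polyC0 TotC tot_SqE raddf0 coef0 big1 // => i _.
  by rewrite polyC0 coef0 raddf0.
rewrite TotD TotM TotX TotC coefD coefMX; case: k => [|k].
  by rewrite big_ord1 add0r coefD coefMX coefC add0r.
rewrite [RHS]big_ord_recl /= addrC; apply: f_equal2.
  by rewrite coefD coefMX coefC add0r subn0.
rewrite IH; apply: eq_bigr => i _.
by rewrite /bump add1n subSS coefD coefMX coefC addr0.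
Qed.

(** In [coef_Tot] every term with i < k is a positive square, so modulo hits the k-th coefficient of
    [Tot P] is that of P. *)
Lemma hit_coef_Tot (P : {poly MP}) k : P`_k = 0 -> hit (Tot P)`_k.
Proof.
move=> Pk0; rewrite coef_Tot; apply: hit_sum => i _.
have [lt|] := ltnP i k; first by apply: hit_Sq; rewrite subn_gt0.
move: (ltn_ord i); rewrite ltnS => le1 le2.
have -> : i = k :> nat by apply/eqP; rewrite eqn_leq le1 le2.
by rewrite Pk0 raddf0; exact: hit0.
Qed.

(* Truncation of the image of x_j under the conjugate total square, which is
   the sum of all x_j^(2^i), graded by 'X. *)
Definition chi_var N (j : 'I_m) : {poly MP} :=
  \sum_(i < N) ('X_j ^+ (2 ^ i))%:P * 'X^(2 ^ i - 1).

Lemma poly_dbl (P : {poly MP}) : P + P = 0.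
Proof. exact: (addrr_pchar2 pchar2_poly). Qed.

Lemma tot_Sq_Xpow2 N (j : 'I_m) : tot_Sq ('X_j ^+ (2 ^ N)) =
  ('X_j ^+ (2 ^ N))%:P + ('X_j ^+ (2 ^ N.+1))%:P * 'X^(2 ^ N).
Proof.
rewrite tot_SqXn tot_SqX -mul_polyC; elim: N => [|N IH]; first by rewrite !expr1.
rewrite !(expnSr 2 N.+1) (expnSr 2 N) 2!exprM IH sqrrD mulr2n poly_dbl addr0.
by rewrite exprMn -!rmorphXn /= -!exprM -!expnSr.
Qed.

(** The i-th summand is sent to itself plus the (i+1)-st, so the sum telescopes modulo 2 and only
    the two ends survive. For N = 0 these ends coincide and cancel. *)
Lemma Tot_chi_var N j :
  Tot (chi_var N j) = ('X_j)%:P + ('X_j ^+ (2 ^ N))%:P * 'X^(2 ^ N - 1).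
Proof.
rewrite /chi_var; elim: N => [|N IH].
  rewrite big_ord0 expn0 subnn expr0 mulr1 expr1 poly_dbl.
  by rewrite /Tot raddf0 horner0.
rewrite big_ord_recr /= TotD IH TotM TotXn TotX TotC tot_Sq_Xpow2.
rewrite mulrDl -mulrA -exprD -addrA; congr (_ + _); rewrite addrA poly_dbl add0r.
by congr (_ * 'X^_); rewrite expnS mul2n -addnn addnBA ?expn_gt0.
Qed.

Definition chi_prod N (s : seq 'I_m) : {poly MP} := \prod_(j <- s) chi_var N j.

(** R is left unspecified because only coefficients below 2^N - 1 will be read. *)
Lemma Tot_chi_prod N s : exists R,
  Tot (chi_prod N s) = (\prod_(j <- s) 'X_j)%:P + 'X^(2 ^ N - 1) * R.
Proof.
elim: s => [|j s [R IH]].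
  by exists 0; rewrite /chi_prod !big_nil mulr0 addr0 TotC tot_SqE rmorph1.
exists (('X_j)%:P * R + ('X_j ^+ (2 ^ N))%:P * Tot (chi_prod N s)).
rewrite /chi_prod !big_cons TotM -/(chi_prod N s) Tot_chi_var mulrDl {1}IH.
by rewrite polyCM mulrDr -addrA; congr (_ + _); ring.
Qed.

(** Each factor contributes some 2^i - 1 to the exponent of the marker; adding 1 per factor turns k
    into a sum of powers of 2. *)
Lemma chi_prod_coef N s k : (chi_prod N s)`_k != 0 -> pow2_sum (size s) (k + size s).
Proof.
elim: s k => [|j s IH] k.
  rewrite /chi_prod big_nil coef1; case: k => [_|k]; last by rewrite eqxx.
  by exists [::]; rewrite big_nil.
rewrite /chi_prod big_cons -/(chi_prod N s) mulr_suml coef_sum => nz.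
have [i] : exists i : 'I_N, (('X_j ^+ (2 ^ i))%:P * 'X^(2 ^ i - 1) * chi_prod N s)`_k != 0.
  apply/existsP; apply: contraNT nz; rewrite negb_exists => /forallP h.
  by rewrite big1 // => i _; apply/eqP; have := h i; rewrite negbK.
rewrite -mulrA coefCM coefXnM; case: ltnP => [_|le]; first by rewrite mulr0 eqxx.
have [-> | /IH[e [se he]] _] := eqVneq (chi_prod N s)`_(k - (2 ^ i - 1)) 0.
  by rewrite mulr0 eqxx.
exists (val i :: e); split; first by rewrite /= se.
have := expn_gt0 2 i; rewrite big_cons -he /= => ?; lia.
Qed.

(** The top coefficient of the total square takes x_j^2 'X from every factor. The predicate Q, a
    degree bound together with the coefficient at that degree, is multiplicative. *)
Lemma Sq_mdeg u : Sq (mdeg u) 'X_[u] = 'X_[u] ^+ 2 :> MP.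
Proof.
pose Q k f (P : {poly MP}) := (size P <= k.+1)%N /\ P`_k = f.
have QM k l f g P R : Q k f P -> Q l g R -> Q (k + l)%N (f * g) (P * R).
  move=> [sP <-] [sR <-]; split.
    by apply: leq_trans (size_polyMleq _ _) _; lia.
  rewrite coefM (bigD1 (Ordinal (leq_addr l k : k < (k + l).+1)%N)) //= addKn.
  rewrite big1 ?addr0 // => i; rewrite -val_eqE /= => ne.
  have [lt|le] := ltnP i k; last first.
    by rewrite (nth_default _ (_ : size P <= i)%N) ?mul0r //; apply: leq_trans sP _; lia.
  by rewrite [R`_ _]nth_default ?mulr0 //; apply: leq_trans sR _; lia.
suff [] : Q (mdeg u) ('X_[u] ^+ 2) (tot_Sq 'X_[u]) by [].
rewrite tot_SqE mmapX /mmap1 mdegE [in 'X_[u] ^+ 2]mpolyXE_id -prodrXl.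
elim/big_rec3: _ => [|i P f k _ hP].
  by split; rewrite ?size_poly1 // coef1.
apply: (QM) hP; elim: (u i) => [|n IH].
  by split; rewrite ?expr0 ?expr1n ?size_poly1 // coef1.
rewrite [X in Q _ _ X]exprS [X in Q _ (X ^+ 2) _]exprS exprMn -add1n.
apply: QM IH; split.
  rewrite (leq_trans (size_polyD _ _)) // geq_max size_polyC -mul_polyC.
  rewrite (leq_trans (leq_b1 _)) //= (leq_trans (size_polyMleq _ _)) //.
  by rewrite size_polyX size_polyC addn2 /= ltnS leq_b1.
by rewrite coefD coefC coefZ coefX add0r mulr1.
Qed.

Lemma hit_mul_sqr T u : ~ pow2_sum #|T| (mdeg u + #|T|) ->
  hit ('X_[ind_mnm T] * 'X_[u] ^+ 2).
Proof.
(* This N makes 2^N - 1 > k, so the truncation error in [Tot_chi_prod] does not reach coefficient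
   k. *)
move=> npow; pose k := mdeg u; pose N := k.+2; rewrite -Sq_mdeg.
have [R hR] := Tot_chi_prod N (enum T).
have -> : 'X_[ind_mnm T] * Sq (mdeg u) 'X_[u] =
    (Tot (chi_prod N (enum T) * 'X_[u]%:P))`_k.
  rewrite TotM TotC hR big_enum -mpolyX_ind mulrDl coefD coefCM -mulrA coefXnM.
  by rewrite ifT ?addr0 //; have := ltn_expl N (ltnSn 1); rewrite /N; lia.
apply: hit_coef_Tot; rewrite coefMC.
have [->|] := eqVneq (chi_prod N (enum T))`_k 0; first by rewrite mul0r.
by move/chi_prod_coef; rewrite -cardE.
Qed.

Lemma Qdim_hit r ps : ~ pow2_sum r (degs ps + r) -> Qdim_le (r :: ps) 0.
Proof.
move=> npow; exists [::]; split=> // u /has_par_inv[cT hv]; exists [::]; split=> //.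
rewrite big_nil addr0 (mnm_halfE u) Xmul; apply: hit_triv.
by apply: hit_mul_sqr; rewrite cT (mdeg_degs hv).
Qed.

(** * Exchange relations from Sq^1 *)

Lemma Sq1_mul_sqr f g : Sq 1 (f * g ^+ 2) = Sq 1 f * g ^+ 2.
Proof.
rewrite Sq_cartan big_ord_recl big_ord1 lift0 subnn subn0.
suff -> : Sq 1 (g ^+ 2) = 0 by rewrite mulr0 add0r Sq0.
rewrite /Sq tot_SqXn expr2 coefM big_ord_recl big_ord1 lift0 subnn subn0.
by rewrite mulrC mpoly_dbl.
Qed.

Lemma Sq1_prod (s : seq 'I_m) :
  Sq 1 (\prod_(j <- s) 'X_j) = (\sum_(j <- s) 'X_j) * \prod_(j <- s) 'X_j :> MP.
Proof.
elim: s => [|j s IH].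
  by rewrite !big_nil mul0r /Sq tot_SqE rmorph1 coef1.
rewrite !big_cons Sq_cartan big_ord_recl big_ord1 lift0 subnn subn0 !Sq0 IH.
rewrite -[X in Sq 1 X]expr1 Sq_Xn bin1 mulr1n; ring.
Qed.

Lemma ind_mnmU T j : j \notin T -> ind_mnm (j |: T) = (U_(j) + ind_mnm T)%MM.
Proof.
move=> jT; apply/mnmP => i; rewrite mnmDE !mnmE !inE [i == j]eq_sym.
by case: eqP => [<-|_]; rewrite ?(negPf jT).
Qed.

Lemma ind_mnmD1 T j : j \in T -> ind_mnm T = (U_(j) + ind_mnm (T :\ j))%MM.
Proof. by move=> jT; rewrite -[in LHS](setD1K jT) ind_mnmU // !inE eqxx. Qed.

(** Sq^1 vanishes on squares, so it acts on z_A alone and replaces one x_a by x_a^2. When a is in B,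
    the product x_a z_B has only #|B| - 1 odd exponents, and the term is lower at the second
    entry. *)
Lemma exchange_rel ps (A B : {set 'I_m}) r0 r1 v :
  #|A| = r0.+1 -> #|B|.+1 = r1 -> has_par ps v ->
  triv [:: r0, r1 & ps]
    (\sum_(a in A :\: B) 'X_[(ind_mnm (A :\ a) + (ind_mnm (a |: B) + v *+ 2) *+ 2)%MM]).
Proof.
move=> cA cB hv.
pose F a : MP := 'X_[(ind_mnm (A :\ a) + (U_(a) + (ind_mnm B + v *+ 2)) *+ 2)%MM].
have SqF : Sq 1 ('X_[ind_mnm A] * 'X_[(ind_mnm B + v *+ 2)%MM] ^+ 2) =
    \sum_(a in A) F a.
  rewrite Sq1_mul_sqr mpolyX_ind.
  have /= := Sq1_prod (enum A); rewrite !big_enum /= => ->.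
  rewrite -mpolyX_ind !mulr_suml; apply: eq_bigr => a aA.
  rewrite mpolyXn -!mpolyXD; congr 'X_[_].
  apply/mnmP => i; rewrite (ind_mnmD1 aA) !(mnmDE, mulmnE); lia.
rewrite (eq_bigr F) => [|a]; last first.
  by rewrite inE => /andP[aB _]; rewrite (ind_mnmU aB) /F addmA.
have -> : \sum_(a in A :\: B) F a = \sum_(a in A) F a + \sum_(a in A :&: B) F a.
  rewrite [X in X + _](big_setID B) /= addrAC mpoly_dbl add0r //.
apply: trivD; first by rewrite -SqF; apply: hit_triv; exact: hit_Sq.
apply: lower_triv; apply: msub_sum => a; rewrite inE => /andP[aA aB].
have cA' : #|A :\ a| = r0 by move: cA; rewrite (cardsD1 a) aA => -[].
apply: msubX; apply: lowerS => //; apply: lower0.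
rewrite addmA par_dbl0 (ind_mnmD1 aB).
have -> : (U_(a) + (U_(a) + ind_mnm (B :\ a)) = ind_mnm (B :\ a) + U_(a) *+ 2)%MM.
  by apply/mnmP => i; rewrite !(mnmDE, mulmnE); lia.
rewrite par_ind0.
by rewrite -cB ltnS subset_leq_card // subsetDl.
Qed.

(* Lexicographic comparison of the indicator functions: the smallest element
   of the symmetric difference lies in T1. *)
Definition swap_bad (T0 T1 : {set 'I_m}) :=
  [exists a in T1 :\: T0, [forall b in T0 :\: T1, a < b]%N].

(** Equal cardinality makes both differences nonempty; the smaller of their two minima decides. *)
Lemma swap_bad_total T0 T1 : #|T0| = #|T1| -> T0 != T1 ->
  swap_bad T0 T1 || swap_bad T1 T0.
Proof.
move=> c ne.
have sz (X Y : {set 'I_m}) : #|X| = #|Y| -> X != Y -> exists a, a \in X :\: Y.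
  move=> cXY neXY; apply/set0Pn; apply: contraNneq neXY => /eqP; rewrite setD_eq0 => sub.
  by rewrite eqEcard sub cXY /=.
have [a0 ha0] := sz _ _ c ne.
have [b0 hb0] : exists b, b \in T1 :\: T0 by apply: sz; rewrite ?c // eq_sym.
case: (arg_minnP (fun x : 'I_m => x : nat) ha0) => a ha mina.
case: (arg_minnP (fun x : 'I_m => x : nat) hb0) => b hb minb.
have {}ha : a \in T0 :\: T1 by [].
have {}hb : b \in T1 :\: T0 by [].
have : (a : nat) != b.
  apply/eqP => /val_inj ab; move: ha hb.
  by rewrite ab !inE => /andP[/negPf ->]; rewrite andbF.
rewrite neq_ltn => /orP[lt|lt]; apply/orP; [right|left].
  apply/existsP; exists a; rewrite ha; apply/forallP => x; apply/implyP => hx.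
  by apply: leq_trans lt _; exact: minb.
apply/existsP; exists b; rewrite hb; apply/forallP => x; apply/implyP => hx.
by apply: leq_trans lt _; exact: mina.
Qed.

Definition ksets r := [set T : {set 'I_m} | #|T| == r].

Definition good_pairs r : {set {set 'I_m} * {set 'I_m}} :=
  [set P in setX (ksets r) (ksets r) | ~~ swap_bad P.1 P.2].

(** By [swap_bad_total], swapping the components maps good pairs off the diagonal injectively to bad
    pairs. *)
Lemma card_good_pairs r :
  (#|good_pairs r| <= ('C(m, r) * ('C(m, r)).+1) %/ 2)%N.
Proof.
pose all := setX (ksets r) (ksets r); pose diag := [set (T, T) | T in ksets r].
pose sw (P : {set 'I_m} * {set 'I_m}) := (P.2, P.1).
have cK : #|ksets r| = 'C(m, r) by rewrite card_draws card_ord.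
have cD : #|diag| = 'C(m, r) by rewrite card_imset // => ? ? [].
have cG : (#|good_pairs r :\: diag| <= #|all :\: good_pairs r|)%N.
  have swI : injective sw by move=> [? ?] [? ?] [-> ->].
  rewrite -(card_imset (good_pairs r :\: diag) swI); apply/subset_leq_card/subsetP => Q.
  case/imsetP => -[T0 T1]; rewrite !inE /= => /andP[nd /andP[/andP[c0 c1] g]] ->.
  rewrite /= c0 c1 !andbT andTb.
  rewrite negbK; have := @swap_bad_total T0 T1; rewrite (negPf g) /=; apply.
    by rewrite (eqP c0) (eqP c1).
  apply: contraNneq nd => ->; apply: imset_f; by rewrite inE.
have sG : good_pairs r \subset all by apply/subsetP => P; rewrite inE => /andP[].
have := cardsD all (good_pairs r); rewrite (setIidPr sG) cardsX cK => cE.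
have := subset_leq_card sG; rewrite cardsX cK => leA.
have := subset_leq_card (subsetIr (good_pairs r) diag); rewrite cD => leD.
have := cardsID diag (good_pairs r) => eqG.
rewrite leq_divRL // mulnS -/all; move: leA cE leD eqG cG.
move: #|all :\: good_pairs r| #|good_pairs r :\: diag| #|good_pairs r :&: diag|.
move: #|good_pairs r| ('C(m, r) * 'C(m, r))%N 'C(m, r) => x y z a b c; lia.
Qed.

Lemma Qdim_pair r ps N : Qdim_le ps N ->
  Qdim_le [:: r, r & ps] (('C(m, r) * ('C(m, r)).+1) %/ 2 * N).
Proof.
move=> [L [sL hL gL]].
pose M (T0 T1 : {set 'I_m}) v := (ind_mnm T0 + (ind_mnm T1 + v *+ 2) *+ 2)%MM.
pose L' := [seq M P.1 P.2 v | P <- enum (good_pairs r), v <- L]; exists L'.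
have genM v : v \in L -> forall T0 T1, #|T0| = r -> #|T1| = r ->
    gen [:: r, r & ps] L' 'X_[M T0 T1 v].
  move=> vL T0; move: {2}(\sum_(a in T0) a)%N (leqnn (\sum_(a in T0) a)%N) => n.
  (* An exchange replaces an element of T0 by a smaller one. *)
  elim/ltn_ind: n T0 => n IH T0 len T1 c0 c1.
  have [|] := boolP (swap_bad T0 T1); last first.
    move=> good; apply: gen_mem; apply/allpairsP; exists ((T0, T1), v); split=> //.
    by rewrite mem_enum !inE /= c0 c1 !eqxx.
  case/existsP => a /andP[aT /forallP amin]; move: aT; rewrite inE => /andP[aT0 aT1].
  (* The summand at a of the exchange relation for (A, B) is the given monomial. Every other b lies
     in T0 but not in T1, so a < b and trading b for a lowers the sum of the elements of T0. *)
  pose A := a |: T0; pose B := T1 :\ a.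
  have cA : #|A| = r.+1 by rewrite cardsU1 aT0 c0.
  have cB : #|B|.+1 = r by rewrite -c1 (cardsD1 a T1) aT1.
  have aAB : a \in A :\: B by rewrite !inE eqxx.
  have := exchange_rel cA cB (hL _ vL).
  rewrite (bigD1 a) //= setU1K // setD1K // => rel.
  apply: gen_triv rel _; apply: gen_sum => b.
  rewrite !inE negb_and negbK => /andP[/andP[bB bA] ba].
  rewrite (negPf ba) /= in bB bA.
  have lt : (a < b)%N by have /implyP := amin b; apply; rewrite inE bB bA.
  have cA' : #|A :\ b| = r.
    by move: cA; rewrite (cardsD1 b) !inE bA orbT => -[].
  apply: (IH (\sum_(x in A :\ b) x)%N) => //; last first.
    by rewrite cardsU1 !inE ba bB -cB.
  apply: leq_trans len; move: (erefl (\sum_(x in A) x)%N).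
  rewrite {1}(big_setD1 b) ?inE ?bA ?orbT //= {1}/A big_setU1 //=.
  rewrite -/A => e; move: lt e.
  move: (\sum_(x in A :\ b) x)%N (\sum_(x in T0) x)%N (nat_of_ord a) (nat_of_ord b); lia.
split.
- by rewrite size_allpairs -cardE leq_mul // card_good_pairs.
- move=> _ /allpairsP[[P v] /= [GP vL ->]]; move: GP.
  rewrite mem_enum !inE => /andP[/andP[/eqP c0 /eqP c1] _].
  by do 2!apply: has_par_cons => //; exact: hL.
move=> u /has_par_inv[c0 /has_par_inv[c1 /gL gu]].
rewrite (mnm_halfE u) (mnm_halfE (half_mnm u)) Xmul.
apply: gen_trans (gen_mul c0 _) _ => [|_ /mapP[v vL ->]].
  by rewrite Xmul; exact: gen_mul c1 gu.
by case/mapP: vL => w wL ->; exact: genM.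
Qed.

(** * From spanning sets to [dim_Q] *)

Lemma degsE ps : degs ps = (\sum_(0 <= i < size ps) 2 ^ i * nth 0 ps i)%N.
Proof.
elim: ps => [|r ps IH]; first by rewrite big_nil.
rewrite /= big_nat_recl // expn0 mul1n IH big_distrr /=; congr addn.
by apply: eq_bigr => i _; rewrite expnS mulnA.
Qed.

Lemma deg_param_degs (p : param_vector) ps :
  (forall i, p i = nth 0%N ps i) -> deg_param p = degs ps.
Proof.
move=> hp; rewrite degsE /deg_param.
have pe : perm_eq (finsupp p) [seq i <- index_iota 0 (size ps) | p i != 0%N].
  apply: uniq_perm; rewrite ?filter_uniq ?iota_uniq ?fset_uniq // => i.
  rewrite mem_finsupp mem_filter mem_index_iota /=; case: ltnP; rewrite ?andbT //.
  by move=> le; rewrite hp nth_default ?eqxx.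
rewrite (perm_big _ pe) /= big_filter big_mkcond; apply: eq_bigr => i _.
by rewrite -hp; case: eqP => // ->; rewrite muln0.
Qed.

(** The squares are homogeneous operations, so hit polynomials form a graded subspace. *)
Lemma hit_pihomog d f : hit f -> hit (pihomog mdeg d f).
Proof.
elim/hit_ind => [|f1 f2 h1 h2|k g]; first by rewrite raddf0; exact: hit0.
  by rewrite raddfD; exact: hitD.
rewrite [g]mpolyE1 !raddf_sum; apply: hit_sum => u _ /=.
have hX : Sq k.+1 'X_[u] \is (mdeg u + k.+1).-homog for mdeg.
  by apply: (@Sq_homog m); rewrite dhomogX /=.
have [<-|ne] := eqVneq (mdeg u + k.+1)%N d.
  by rewrite pihomog_dE //; exact: hit_Sq.
by rewrite (pihomog_ne0 ne hX); exact: hit0.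
Qed.

Lemma to_homog_sum d (I : Type) (s : seq I) (P : pred I) (F : I -> MP) :
  (forall i, P i -> F i \is d.-homog for mdeg) ->
  to_homog d (\sum_(i <- s | P i) F i) = \sum_(i <- s | P i) to_homog d (F i).
Proof.
move=> hF; apply: val_inj => /=; rewrite to_homogE ?rpred_sum //.
rewrite (big_morph (@mpoly_of_dhomog m _ d) (id1 := 0) (op1 := +%R)) //.
by apply: eq_bigr => i /hF Pi; rewrite to_homogE.
Qed.

Lemma to_homogD d f g : f \is d.-homog for mdeg -> g \is d.-homog for mdeg ->
  to_homog d (f + g) = to_homog d f + to_homog d g.
Proof.
by move=> hf hg; apply: val_inj; rewrite /= !to_homogE ?rpredD.
Qed.

(** The images of the generators span [poly_le] modulo [sim_zero], and a sum of subspaces has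
    dimension at most the sum of dimensions. *)
Lemma dim_Q_le (p : param_vector) ps N :
  (forall i, p i = nth 0%N ps i) -> Qdim_le ps N -> (dim_Q m p <= N)%N.
Proof.
move=> hp [L [sL hL gL]]; set d := deg_param p.
have dE : d = degs ps by exact: deg_param_degs.
have parE u : has_par ps u <-> Param_monom u = p.
  split=> [h|eq i]; last by rewrite -hp -eq Param_monomE.
  by apply/fsfunP => i; rewrite Param_monomE hp -h.
have XH u : mdeg u = d -> ('X_[u] : MP) \is d.-homog for mdeg by rewrite dhomogX => /eqP.
pose V := <<[seq to_homog d 'X_[v] | v <- L]>>%VS.
have bm u : mdeg u = d -> (mdeg u < d.+1)%N by move=> ->.
have in_le u : mdeg u = d -> param_le (Param_monom u) p -> to_homog d 'X_[u] \in poly_le m p.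
  move=> du le; apply: memv_span; apply/imageP; exists (BMultinom (bm _ du)) => //.
  by rewrite inE /= -/d du eqxx.
have in_lt u : mdeg u = d -> lower ps u -> to_homog d 'X_[u] \in poly_lt m p.
  move=> du [i [lt eq]]; apply: memv_span; apply/imageP; exists (BMultinom (bm _ du)) => //.
  rewrite inE /= -/d du eqxx /=; apply/param_ltP; exists i.
  rewrite Param_monomE hp; split=> // j ltj; rewrite Param_monomE hp; exact: eq.
have sub : (poly_le m p <= V + sim_zero m p)%VS.
  apply/span_subvP => x /imageP[u].
  rewrite inE => /andP[/eqP du /orP[/eqP eq|lt]] -> {x}; last first.
    apply: subvP (addvSr _ _) _ _; apply: subvP (addvSr _ _) _ _.
    apply: memv_span; apply/imageP; exists u => //; by rewrite inE du eqxx.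
  (* Here h and l may have components in several degrees. As the left side is homogeneous, their
     degree d parts h' and l' satisfy the same relation. *)
  have [s [sS [h [l [hh hl e]]]]] := gL u ((parE u).2 eq).
  have sd v : v \in s -> mdeg v = d by move=> /sS/hL/mdeg_degs ->.
  pose h' := to_homog d (pihomog mdeg d h); pose l' := to_homog d (pihomog mdeg d l).
  pose S' := \sum_(v <- s) to_homog d 'X_[v].
  have hS : (\sum_(v <- s) 'X_[v] : MP) \is d.-homog for mdeg.
    by rewrite big_seq; apply: rpred_sum => v /sd /XH.
  have S'E : to_homog d (\sum_(v <- s) 'X_[v]) = S'.
    rewrite /S' big_seq [RHS]big_seq; apply: to_homog_sum => v /sd; exact: XH.
  have eq1 : to_homog d 'X_[u] + S' = h' + l'.
    have e' : 'X_[u] + \sum_(v <- s) 'X_[v] = pihomog mdeg d h + pihomog mdeg d l.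
      transitivity (pihomog mdeg d (h + l)); last exact: raddfD.
      by rewrite -e pihomog_dE // rpredD ?XH.
    by rewrite -S'E -to_homogD ?XH // e' to_homogD ?pihomogP.
  have S'V : S' \in V.
    rewrite /S' big_seq; apply: memv_suml => v vs; apply: memv_span.
    by apply: map_f; exact: sS.
  have S'le : S' \in poly_le m p.
    rewrite /S' big_seq; apply: memv_suml => v vs; apply: in_le; first exact: sd.
    by rewrite /param_le ((parE v).1 _) ?eqxx //; apply/hL/sS.
  have l'lt : l' \in poly_lt m p.
    have lE : pihomog mdeg d l = \sum_(v <- msupp l | mdeg v == d) 'X_[v].
      by rewrite {1}[l]mpolyE1 raddf_sum [RHS]big_mkcond; apply: eq_bigr => v _ /=; rewrite pihomogX.
    rewrite /l' lE to_homog_sum => [|v /eqP]; last exact: XH.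
    rewrite big_seq_cond; apply: memv_suml => v /andP[vl /eqP vd].
    by apply: in_lt vd _; exact: hl.
  have l'S : l' \in sim_zero m p by apply: subvP (addvSr _ _) _ l'lt.
  have -> : to_homog d 'X_[u] = - S' + (h' + l') by rewrite -eq1 addrCA addNr addr0.
  apply: memv_add; first by rewrite memvN.
  apply: memvD => //; apply: subvP (addvSl _ _) _ _; rewrite memv_cap.
  have -> : h' \in hit_deg m (deg_param p).
    by apply/hit_degP; rewrite to_homogE ?pihomogP //; exact: hit_pihomog.
  rewrite andTb.
  (* [sim_zero] takes only hits inside [poly_le]; the relation expresses h' through elements of that
     space. *)
  have -> : h' = to_homog d 'X_[u] + S' - l' by rewrite eq1 addrK.
  apply: memvB; last by apply: subvP (sim_zero_sub _ _) _ _.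
  by apply: memvD => //; apply: in_le => //; rewrite /param_le eq eqxx.
rewrite /dim_Q leq_subLR; apply: leq_trans (dimvS sub) _.
apply: leq_trans (leq_of_leqif (dimv_add_leqif _ _)) _; rewrite addnC leq_add2l.
by apply: leq_trans (dim_span _) _; rewrite size_map.
Qed.
End Quotient.

(** * The degrees n_s in five variables *)

(** The worst case of [Qdim_cons] over the possible first entries r. The argument n is fuel; n >= d
    suffices because the tail has smaller degree. *)
Fixpoint naive_bound (n d : nat) : nat :=
  if n isn't n'.+1 then 1 else if d == 0 then 1 else
  foldr maxn 0 [seq 'C(5, r) * naive_bound n' (d - r)./2
               | r <- iota 0 6 & (r <= d) && ~~ odd (d - r)].

Lemma naive_boundS n d : naive_bound n.+1 d = if d == 0 then 1 else
  foldr maxn 0 [seq 'C(5, r) * naive_bound n (d - r)./2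
               | r <- iota 0 6 & (r <= d) && ~~ odd (d - r)].
Proof. by []. Qed.

Lemma foldr_maxn_ge (s : seq nat) x : x \in s -> x <= foldr maxn 0 s.
Proof.
elim: s => //= y s IH; rewrite inE => /orP[/eqP ->|/IH le]; first exact: leq_maxl.
by rewrite leq_max le orbT.
Qed.

Lemma Qdim_naive n d ps : degs ps = d -> d <= n -> Qdim_le 5 ps (naive_bound n d).
Proof.
elim: n d ps => [|n IH] d ps dE le; first by apply: Qdim_degs0; lia.
rewrite naive_boundS; have [d0|d0] := eqVneq d 0; first by apply: Qdim_degs0; rewrite dE.
case: ps dE => [|r ps] dE; first by rewrite -dE in d0.
have {}dE : r + 2 * degs ps = d by [].
have [lt|ler] := ltnP 5 r; first exact: Qdim_leW (Qdim_big ps lt).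
have psE : degs ps = (d - r)./2 by lia.
apply: Qdim_leW (Qdim_cons r (IH _ ps psE _)); last by lia.
apply: foldr_maxn_ge; apply/mapP; exists r => //.
by rewrite mem_filter mem_iota; lia.
Qed.

(** The vector (1, 1) gives 5 * 6 / 2 = 15 by exchange, where counting gives 25; the vector (3)
    gives 10. *)
Lemma Qdim_deg3 ps : degs ps = 3 -> Qdim_le 5 ps 15.
Proof.
case: ps => [|r ps] //= dE; have : r = 3 \/ r = 1 by lia.
case=> rE; rewrite {}rE in dE *.
  by apply: Qdim_leW (Qdim_cons 3 (Qdim_degs0 5 (_ : degs ps = 0))) => //; lia.
case: ps dE => [|r1 ps] //= dE; have -> : r1 = 1 by lia.
by apply: Qdim_leW (Qdim_pair 1 (Qdim_degs0 5 (_ : degs ps = 0))) => //; lia.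
Qed.

Lemma Qdim_deg8 ps : degs ps = 8 -> Qdim_le 5 ps 150.
Proof.
case: ps => [|r ps] //= dE; have [lt|ler] := ltnP 5 r.
  exact: Qdim_leW (Qdim_big ps lt).
have : r = 0 \/ r = 2 \/ r = 4 by lia.
case=> [rE|[rE|rE]]; rewrite {}rE in dE *.
- have e : degs ps = 4 by lia.
  exact: Qdim_leW (Qdim_cons 0 (Qdim_naive e (leqnn _))).
- have e : degs ps = 3 by lia.
  exact: Qdim_leW (Qdim_cons 2 (Qdim_deg3 e)).
have e : degs ps = 2 by lia.
exact: Qdim_leW (Qdim_cons 4 (Qdim_naive e (leqnn _))).
Qed.

Lemma pow2_sum1 n : pow2_sum 1 n -> exists i, n = 2 ^ i.
Proof.
by case=> e [+ ->]; case: e => [|i [|? ?]] // _; exists i; rewrite big_seq1.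
Qed.

Lemma pow2_sum3 n : pow2_sum 3 n -> exists i j k, n = 2 ^ i + 2 ^ j + 2 ^ k.
Proof.
case=> e [+ ->]; case: e => [|i [|j [|k [|? ?]]]] // _; exists i, j, k.
by rewrite !big_cons big_nil addn0 addnA.
Qed.

Lemma pow2_small i n : 2 ^ i = n -> n <= 63 -> n \in [:: 1; 2; 4; 8; 16; 32].
Proof.
move=> <-; case: i => [|[|[|[|[|[|i]]]]]] //.
by move=> le; exfalso; move: le; rewrite !expnS; have := expn_gt0 2 i; lia.
Qed.

(** For (3, 1) the criterion fails to be met by 9 + 1 = 10, not a power of 2. Exchange bounds (3, 3)
    by 55 * 150 = 8250, and counting bounds (3, 5) by 10 * 125. *)
Lemma Qdim_deg19 ps : degs ps = 19 -> Qdim_le 5 (3 :: ps) 9765.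
Proof.
case: ps => [|r ps] //= dE; have [lt|ler] := ltnP 5 r.
  exact: Qdim_leW (Qdim_cons 3 (Qdim_big ps lt)).
have : r = 1 \/ r = 3 \/ r = 5 by lia.
case=> [rE|[rE|rE]]; rewrite {}rE in dE *.
- have e : degs ps = 9 by lia.
  suff h : Qdim_le 5 (1 :: ps) 0 by exact: Qdim_leW (Qdim_cons 3 h).
  apply: Qdim_hit; rewrite e => /pow2_sum1[i /esym e10].
  by have := pow2_small e10 isT.
- have e : degs ps = 8 by lia.
  exact: Qdim_leW (Qdim_pair 3 (Qdim_deg8 e)).
have e : degs ps = 7 by lia.
exact: Qdim_leW (Qdim_cons 3 (Qdim_cons 5 (Qdim_naive e (leqnn _)))).
Qed.

(** From t = 2 on the right side is 2 modulo 4 and too large to be 2. It is what first entry 1 in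
    degree n_(t+1) = 23 * 2^(t+1) - 5 requires to be a power of 2. *)
Lemma pow2_ne t i : 2 ^ i <> 23 * 2 ^ t - 2.
Proof.
case: t => [|[|t]] e; [by have := pow2_small e isT|by have := pow2_small e isT|].
case: i e => [|[|i]]; rewrite !expnS; have := expn_gt0 2 t; lia.
Qed.

Lemma pow2D_ne t i j : 2 ^ i + 2 ^ j <> 23 * 2 ^ t - 1.
Proof.
case: t => [|t] e.
  have := @pow2_small i _ erefl; have := @pow2_small j _ erefl.
  by rewrite !inE; lia.
case: i j e => [|i] [|j] e; try by move: e; rewrite !expnS; have := expn_gt0 2 t; lia.
- by apply: (@pow2_ne t.+1 j.+1); lia.
by apply: (@pow2_ne t.+1 i.+1); lia.
Qed.

(** By parity exactly one exponent is 0; halving the rest leads to [pow2D_ne]. The exponent t + 1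
    matters, since 23 - 1 = 16 + 4 + 2. *)
Lemma pow2D3_ne t i j k : 2 ^ i + 2 ^ j + 2 ^ k <> 23 * 2 ^ t.+1 - 1.
Proof.
move=> e; have := expn_gt0 2 t => t0.
case: i j k e => [|i] [|j] [|k]; rewrite !expnS => e; try lia.
- by apply: (@pow2D_ne t j k); lia.
- by apply: (@pow2D_ne t i k); lia.
by apply: (@pow2D_ne t i j); lia.
Qed.

(** For s > 0 the degree is odd, which leaves first entries 1, 3 and 5, and n_(s+1) = 5 + 2 n_s
    sends entry 5 to the induction hypothesis. The bound is 9765 = 1 * 3 * 7 * 15 * 31. *)
Lemma Qdim_main s ps : degs ps = 5 * (2 ^ s - 1) + 18 * 2 ^ s -> Qdim_le 5 ps 9765.
Proof.
elim: s ps => [|s IH] ps dE.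
  exact: Qdim_leW (Qdim_naive dE (leqnn _)).
case: ps dE => [|r ps] /=; have := expn_gt0 2 s; rewrite expnS => s0 dE; first by lia.
have [lt|ler] := ltnP 5 r; first exact: Qdim_leW (Qdim_big ps lt).
have : r = 1 \/ r = 3 \/ r = 5 by lia.
case=> [rE|[rE|rE]]; rewrite {}rE in dE *; last first.
- apply: Qdim_leW (Qdim_cons 5 (IH ps _)) => //; lia.
(* In degree 41 the number to test is 22 = 16 + 4 + 2, so the power of 2 criterion gives nothing for
   first entry 3 and the second entry has to be examined. *)
- case: s s0 dE {IH} => [|s] s0 dE; first by apply: Qdim_deg19; lia.
  apply: (@Qdim_leW _ _ 0) => //; apply: Qdim_hit => /pow2_sum3[i [j [k e]]].
  by apply: (@pow2D3_ne s i j k); rewrite -e expnS in dE *; lia.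
apply: (@Qdim_leW _ _ 0) => //; apply: Qdim_hit => /pow2_sum1[i e].
by apply: (@pow2_ne s i); lia.
Qed.

Theorem corollary4p1p7 (s : nat) (p : param_vector) :
  deg_param p = 5 * (2 ^ s - 1) + 18 * 2 ^ s ->
  dim_Q 5 p <= \prod_(1 <= j < 6) (2 ^ j - 1).
Proof.
have [ps hp] : exists ps, forall i, p i = nth 0 ps i.
  exists (mkseq p (\max_(i <- finsupp p) i).+1) => i.
  case: (ltnP i (\max_(i <- finsupp p) i).+1) => [lt|le]; first by rewrite nth_mkseq.
  rewrite nth_default ?size_mkseq //; apply: fsfun_dflt; apply/negP => ip.
  have : i <= \max_(j <- finsupp p) j by exact: leq_bigmax_seq.
  by rewrite leqNgt le.
rewrite (deg_param_degs hp) => /Qdim_main /(dim_Q_le hp) le.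
by apply: leq_trans le _; rewrite unlock; vm_compute.
Qed.
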